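(* Let $p,n,m\ge 1$, $N=n+m$, let $\mathcal{G}_N=\{\boldsymbol g_1,\dots,\boldsymbol g_N\}\subset\mathbb{R}^p$ be a fixed (non-random) grid of $N$ points, and let $w$ be a fixed weight function on $\mathbb{R}^p$. Let $\boldsymbol X_1,\dots,\boldsymbol X_n$ be a random sample from an absolutely continuous distribution $\mathcal{P}_{\boldsymbol X}$ on $\mathbb{R}^p$ with distribution function $F_{\boldsymbol X}$, and let $\boldsymbol X_1^{(0)},\dots,\boldsymbol X_m^{(0)}$ be a random sample, independent of the first one, from the absolutely continuous distribution with distribution function $F_0$. Then under the null hypothesis $\mathcal{H}_0: F_{\boldsymbol X}\equiv F_0$, the distribution of the test statistic $D_{n,m}$ is free of $\mathcal{P}_{\boldsymbol X}$; that is, for given $n,m,\mathcal{G}_N,w$, the law of $D_{n,m}$ is the same for every absolutely continuous distribution $\mathcal{P}_{\boldsymbol X}$ on $\mathbb{R}^p$ (with $F_0=F_{\boldsymbol X}$).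
   Context: Weight function: $w:\mathbb{R}^p\to[0,\infty)$ is measurable with $w(\boldsymbol t)=w(-\boldsymbol t)$ and $\int_{\mathbb{R}^p}w(\boldsymbol t)\,\mathrm{d}\boldsymbol t<\infty$. Empirical optimal transport and multivariate ranks: for the pooled sample $\mathcal{Z}_N=\{\boldsymbol X_1,\dots,\boldsymbol X_n,\boldsymbol X^{(0)}_1,\dots,\boldsymbol X^{(0)}_m\}=\{\boldsymbol Z_1,\dots,\boldsymbol Z_N\}$, the map $\widehat{\boldsymbol G}_N$ is a minimizer of $\sum_{i=1}^N\|\boldsymbol G(\boldsymbol Z_i)-\boldsymbol Z_i\|^2$ over all bijections $\boldsymbol G:\mathcal{Z}_N\to\mathcal{G}_N$. The multivariate ranks are $\boldsymbol R_i=\widehat{\boldsymbol G}_N(\boldsymbol X_i)$, $i=1,\dots,n$, and $\boldsymbol R^{(0)}_j=\widehat{\boldsymbol G}_N(\boldsymbol X^{(0)}_j)$, $j=1,\dots,m$. Test statistic: $$D_{n,m}=\frac{nm}{n+m}\int_{\mathbb{R}^p}\big|\widehat\phi_n(\boldsymbol t)-\widehat\phi^{(0)}_m(\boldsymbol t)\big|^2 w(\boldsymbol t)\,\mathrm{d}\boldsymbol t,$$ where $\widehat\phi_n(\boldsymbol t)=\frac1n\sum_{j=1}^n\exp(\mathrm{i}\,\boldsymbol t^\top\boldsymbol R_j)$ and $\widehat\phi^{(0)}_m(\boldsymbol t)=\frac1m\sum_{j=1}^m\exp(\mathrm{i}\,\boldsymbol t^\top\boldsymbol R^{(0)}_j)$.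 *)

(* Defs.v *)
From HB Require Import structures.
From mathcomp Require Import all_boot all_order all_algebra.
From mathcomp Require Import all_classical all_reals all_analysis.
From mathcomp.real_closed Require Import complex.

Set Implicit Arguments.
Unset Strict Implicit.
Unset Printing Implicit Defensive.

Import Order.TTheory GRing.Theory Num.Theory.
Import numFieldNormedType.Exports.

Local Open Scope classical_set_scope.
Local Open Scope ring_scope.

(* The space R^p is [p.-tuple R] with the library's
   product (that is, Borel) sigma-algebra. *)

Section lebesgue_tuple_step.
Context {R : realType} (p : nat).

Definition tuple_cons (z : measurableTypeR R * p.-tuple R) : p.+1.-tuple R :=
  [the p.+1.-tuple R of z.1 :: z.2].

Lemma measurable_tuple_cons : measurable_fun setT tuple_cons.
Proof.
apply: (@measurable_cons _ _ _ R fst p snd); last exact: measurable_snd.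
exact: (@measurable_fst _ _ (measurableTypeR R)).
Qed.

Variable mu : {sigma_finite_measure set (p.-tuple R) -> \bar R}.

Definition lebesgue_step : set (p.+1.-tuple R) -> \bar R :=
  pushforward (@lebesgue_measure R \x mu)%E tuple_cons.

Let preimage_tuple_cons (A : set (p.+1.-tuple R)) :
  measurable A -> measurable (tuple_cons @^-1` A).
Proof.
by move=> mA; rewrite -[X in measurable X]setTI; exact: measurable_tuple_cons.
Qed.

Let lebesgue_step0 : lebesgue_step set0 = 0%E.
Proof. by rewrite /lebesgue_step /pushforward preimage_set0 measure0. Qed.

Let lebesgue_step_ge0 A : (0 <= lebesgue_step A)%E.
Proof. by rewrite /lebesgue_step /pushforward measure_ge0. Qed.

Let lebesgue_step_sigma_additive : semi_sigma_additive lebesgue_step.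
Proof.
move=> F mF tF mUF; rewrite /lebesgue_step /pushforward preimage_bigcup.
apply: measure_semi_sigma_additive.
- by move=> k; exact: preimage_tuple_cons.
- apply/trivIsetP => /= i j _ _ ij; rewrite -preimage_setI.
  by move/trivIsetP : tF => /(_ _ _ _ _ ij) ->//; rewrite preimage_set0.
- by rewrite -preimage_bigcup; exact: preimage_tuple_cons.
Qed.

HB.instance Definition _ := isMeasure.Build _ _ _ lebesgue_step
  lebesgue_step0 lebesgue_step_ge0 lebesgue_step_sigma_additive.

Lemma lebesgue_step_box (A : set R) (B : set (p.-tuple R)) :
  measurable A -> measurable B ->
  lebesgue_step [set x | A (thead x) /\ B [tuple of behead x]] =
  (lebesgue_measure A * mu B)%E.
Proof.
move=> mA mB; rewrite -product_measure1E// /lebesgue_step /pushforward.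
congr (product_measure1 _ _ _); apply/seteqP; split => -[a b] /=;
  by rewrite /tuple_cons theadE (_ : [tuple of _] = b)//; exact/val_inj.
Qed.

Lemma measurable_tuple_box (A : set R) (B : set (p.-tuple R)) :
  measurable A -> measurable B ->
  measurable [set x : p.+1.-tuple R | A (thead x) /\ B [tuple of behead x]].
Proof.
move=> mA mB; apply: measurableI.
  by have := @measurable_tnth _ R p.+1 ord0 measurableT A mA; rewrite setTI.
by have := @measurable_behead _ R p measurableT B mB; rewrite setTI.
Qed.

Let lebesgue_step_sigma_finite : sigma_finite setT lebesgue_step.
Proof.
have /sigma_finiteP[F [TF ndF Foo]] := sigma_finiteT (@lebesgue_measure R).
have /sigma_finiteP[G [TG ndG Goo]] := sigma_finiteT mu.
exists (fun k => [set x | F k (thead x) /\ G k [tuple of behead x]]).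
  apply/esym; rewrite -subTset => x _.
  have [i _ Fi] : (\bigcup_i F i) (thead x) by rewrite -TF.
  have [j _ Gj] : (\bigcup_i G i) [tuple of behead x] by rewrite -TG.
  exists (maxn i j) => //; split.
    by move: Fi; exact/subsetPset/ndF/leq_maxl.
  by move: Gj; exact/subsetPset/ndG/leq_maxr.
move=> k; have [mF Fk] := Foo k; have [mG Gk] := Goo k.
split; first exact: measurable_tuple_box.
by rewrite lebesgue_step_box// lte_mul_pinfty// ge0_fin_numE.
Qed.

HB.instance Definition _ :=
  Measure_isSigmaFinite.Build _ _ _ lebesgue_step lebesgue_step_sigma_finite.

End lebesgue_tuple_step.

(* Lebesgue measure on R^p, as the p-fold product of the Lebesgue measure on
   the line: [lebesgue_tuple_box] below computes it on measurable boxes. *)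
Fixpoint lebesgue_tuple (R : realType) (p : nat) :
    {sigma_finite_measure set (p.-tuple R) -> \bar R} :=
  match p with
  | 0 => @dirac _ _ [tuple] R
  | p'.+1 => lebesgue_step (lebesgue_tuple R p')
  end.

Lemma lebesgue_tuple_box (R : realType) (p : nat) (A : 'I_p -> set R) :
  (forall k, measurable (A k)) ->
  lebesgue_tuple R p [set x | forall k, A k (tnth x k)] =
  (\prod_(k < p) lebesgue_measure (A k))%E.
Proof.
elim: p A => [|p IH] A mA.
  rewrite big_ord0 /= diracE mem_set//=; by case.
rewrite big_ord_recl -IH; last by move=> k; exact: mA.
rewrite -lebesgue_step_box//; last first.
  rewrite [X in measurable X](_ : _ = \bigcap_(k in setT)
      ((@tnth _ R ^~ k) @^-1` A (lift ord0 k))); last first.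
    by apply/seteqP; split => x /= h k => [_|]; exact: h.
  apply: fin_bigcap_measurable => // k _.
  by have := @measurable_tnth _ R p k measurableT _ (mA (lift ord0 k));
    rewrite setTI.
congr (lebesgue_step _ _); apply/seteqP; split => x /=.
  move=> h; split=> [|k]; first exact: h.
  by have := h (lift ord0 k); rewrite {1}(tuple_eta x) tnthS.
move=> [h0 h] k; have [j ->|->//] := unliftP ord0 k.
by rewrite (tuple_eta x) tnthS; exact: h.
Qed.

Section probability_notions.
Context {d d' : measure_display} {Omega : measurableType d}
  {T : measurableType d'} {R : realType}.
Variable P : probability Omega R.
Local Open Scope ereal_scope.

Definition mutually_independent (k : nat) (X : 'I_k -> {RV P >-> T}) : Prop :=
  forall (J : {set 'I_k}) (A : 'I_k -> set T),
    (forall i, measurable (A i)) ->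
    P (\bigcap_(i in [set i | i \in J]) (X i @^-1` A i)) =
    \prod_(i in J) P (X i @^-1` A i).

Definition random_sample (Q : probability T R) (k : nat)
    (X : 'I_k -> {RV P >-> T}) : Prop :=
  mutually_independent X /\
  forall i A, measurable A -> distribution P (X i) A = Q A.

Definition sample_vector (k : nat) (X : 'I_k -> {RV P >-> T}) (omega : Omega) :
  k.-tuple T := [tuple X i omega | i < k].

Definition independent_samples (n m : nat) (X : 'I_n -> {RV P >-> T})
    (Y : 'I_m -> {RV P >-> T}) : Prop :=
  forall (A : set (n.-tuple T)) (B : set (m.-tuple T)),
    measurable A -> measurable B ->
    P (sample_vector X @^-1` A `&` sample_vector Y @^-1` B) =
    P (sample_vector X @^-1` A) * P (sample_vector Y @^-1` B).

(* [f] is only required to be almost surely equal to a random variable: a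
   statistic built from an almost surely unique minimizer is determined only up
   to a null set, and [P] need not be complete. *)
Definition has_law (f : Omega -> R) (L : probability R R) : Prop :=
  exists Y : {RV P >-> R},
    {ae P, forall omega, f omega = Y omega} /\
    forall B, measurable B -> distribution P Y B = L B.

End probability_notions.

Section euclidean.
Context {R : realType} {p : nat}.

Definition dotp (x y : p.-tuple R) : R := \sum_(k < p) tnth x k * tnth y k.

Definition sqdist (x y : p.-tuple R) : R :=
  \sum_(k < p) (tnth x k - tnth y k) ^+ 2.

Definition tuple_opp (x : p.-tuple R) : p.-tuple R := [tuple - tnth x k | k < p].

Definition distribution_function (Q : probability (p.-tuple R) R)
    (x : p.-tuple R) : \bar R :=
  Q [set y | forall k, tnth y k <= tnth x k].

Definition absolutely_continuous (Q : probability (p.-tuple R) R) : Prop :=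
  Q `<< lebesgue_tuple R p.

Definition weight_function (w : p.-tuple R -> R) : Prop :=
  [/\ measurable_fun setT w,
      forall t, 0 <= w t,
      forall t, w (tuple_opp t) = w t &
      (\int[lebesgue_tuple R p]_t (w t)%:E < +oo)%E].

End euclidean.

Section test_statistic.
Context {R : realType} {p : nat}.

Definition pooled (n m : nat) (x : 'I_n -> p.-tuple R) (x0 : 'I_m -> p.-tuple R)
    (i : 'I_(n + m)) : p.-tuple R :=
  match fintype.split i with inl j => x j | inr j => x0 j end.

(* The bijections between the finite sets [range z] and [range g] are maps of
   the whole space of which only the values on [range z] matter. *)
Definition optimal_transport (N : nat) (z g : 'I_N -> p.-tuple R)
    (G : p.-tuple R -> p.-tuple R) : Prop :=
  set_bij (range z) (range g) G /\
  forall H, set_bij (range z) (range g) H ->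
    \sum_(i < N) sqdist (G (z i)) (z i) <= \sum_(i < N) sqdist (H (z i)) (z i).

(* exp(i theta) *)
Definition expi (theta : R) : R[i] := Complex (cos theta) (sin theta).

Definition empirical_cf (k : nat) (r : 'I_k -> p.-tuple R) (t : p.-tuple R) :
  R[i] := (k%:R)^-1 * \sum_(j < k) expi (dotp t (r j)).

Definition test_statistic (n m : nat) (w : p.-tuple R -> R)
    (r : 'I_n -> p.-tuple R) (r0 : 'I_m -> p.-tuple R) : R :=
  n%:R * m%:R / (n + m)%N%:R *
  \int[lebesgue_tuple R p]_t
    (ComplexField.Normc.normc (empirical_cf r t - empirical_cf r0 t) ^+ 2 * w t).

End test_statistic.

(* Main.v *)
Require Import Defs.
From HB Require Import structures.
From mathcomp Require Import all_boot all_order all_algebra fingroup perm.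
From mathcomp Require Import all_classical all_reals all_analysis.
From mathcomp Require Import measurable_realfun ring.
From mathcomp.real_closed Require Import complex.

Set Implicit Arguments.
Unset Strict Implicit.
Unset Printing Implicit Defensive.

Import Order.TTheory GRing.Theory Num.Theory.
Import numFieldNormedType.Exports.

Local Open Scope classical_set_scope.
Local Open Scope ring_scope.

(* Under the null hypothesis the pooled sample is i.i.d., so its law is invariant
   under permutations. By absolute continuity, two distinct assignments have
   different costs almost surely: their costs tie on a set which is a hyperplane
   in some coordinate. Hence the optimal assignment is almost surely unique, and
   by exchangeability it is uniform on the symmetric group. The statistic is a
   function of that assignment which involves only the grid and the weight. *)

(** * Boxes, and uniqueness of probability measures on tuples *)

Definition tuple_box (T : Type) (n : nat) (A : 'I_n -> set T) :
    set (n.-tuple T) :=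
  [set x | forall i, A i (tnth x i)].

Lemma measurable_box d (T : measurableType d) n (A : 'I_n -> set T) :
  (forall i, measurable (A i)) -> measurable (tuple_box A).
Proof.
move=> mA; rewrite (_ : tuple_box A =
    \bigcap_(i in setT) ((@tnth n T ^~ i) @^-1` A i)); last first.
  by apply/seteqP; split => x /= h i => [_|]; exact: h.
apply: fin_bigcap_measurable => // i _.
by have := @measurable_tnth _ T n i measurableT _ (mA i); rewrite setTI.
Qed.

Section tuple_measure_unique.
Context d (T : measurableType d) (R : realType) (n : nat).
Variables (C : set (set T)) (h : (set T)^nat).
Hypotheses (genC : measurable = <<s C >>) (CI : setI_closed C).
Hypotheses (Ch : forall k, C (h k))
  (ndh : {homo h : i j / (i <= j)%N >-> i `<=` j}).
Hypothesis h_cover : \bigcup_k h k = setT.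

Let boxes : set (set (n.-tuple T)) :=
  [set B | exists2 A : 'I_n -> set T, (forall i, C (A i)) & B = tuple_box A].

(** The point is that cylinders over one coordinate are generated by boxes. Since [C] may lack the
    whole space, the other sides are filled with [h k] and the union is taken over [k]. *)
Let measurable_boxes : @measurable _ (n.-tuple T) = <<s boxes >>.
Proof.
apply/seteqP; split; last first.
  apply: smallest_sub; first exact: sigma_algebra_measurable.
  move=> _ [A CA ->]; apply: measurable_box => i.
  by rewrite genC; exact: sub_sigma_algebra.
move=> B mB; rewrite -[B]setTI.
suff : measurable_fun setT (id : g_sigma_algebraType boxes -> n.-tuple T).
  by move=> /(_ measurableT _ mB).
apply/measurable_fun_tnthP => i; apply: (measurability C genC).
move=> _ [A CA <-]; rewrite setTI.
rewrite (_ : _ @^-1` _ =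
    \bigcup_k tuple_box (fun j => if j == i then A else h k)).
  apply: bigcupT_measurable => k; apply: sub_sigma_algebra.
  by exists (fun j => if j == i then A else h k) => // j; case: ifP.
apply/seteqP; split => x /= => [Ax|[k _ /(_ i)]]; last by rewrite eqxx.
have /choice [k hk] : forall j, exists k, h k (tnth x j).
  move=> j; have : (\bigcup_k h k) (tnth x j) by rewrite h_cover.
  by move=> [k _ hk]; exists k.
(* There are finitely many coordinates and [h] increases, so the largest index serves them all. *)
exists (\max_j k j)%N => // j; case: eqP => [->//|_].
by apply: (ndh (leq_bigmax j)).
Qed.

(** Boxes with sides in [C] form a generating pi-system that exhausts the space. Keeping [C] general
    serves two cases: all measurable sides for product laws, and closed left rays for distribution
    functions. *)
Lemma tuple_measure_unique (P Q : probability (n.-tuple T) R) :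
    (forall A : 'I_n -> set T, (forall i, C (A i)) ->
      P (tuple_box A) = Q (tuple_box A)) ->
  forall E, measurable E -> P E = Q E.
Proof.
move=> PQ; apply: (measure_unique boxes (fun k => tuple_box (fun=> h k))) => //.
- move=> _ _ [A CA ->] [B CB ->]; exists (fun i => A i `&` B i) => [i|].
    exact: CI.
  apply/seteqP; split => x /=; first by move=> [? ?] i.
  by move=> AB; split => i; case: (AB i).
- by move=> k; exists (fun=> h k).
- apply/seteqP; split => // x _.
  have /choice [k hk] : forall j, exists k, h k (tnth x j).
    move=> j; have : (\bigcup_k h k) (tnth x j) by rewrite h_cover.
    by move=> [k _ hk]; exists k.
  by exists (\max_j k j)%N => // j; apply: (ndh (leq_bigmax j)).
- by move=> _ [A CA ->]; exact: PQ.
- by move=> k; rewrite (le_lt_trans _ (ltry 1)) ?probability_le1//;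
    apply: measurable_box => _; rewrite genC; exact: sub_sigma_algebra.
Qed.

End tuple_measure_unique.

Lemma tuple_probability_unique d (T : measurableType d) (R : realType) n
    (P Q : probability (n.-tuple T) R) :
    (forall A : 'I_n -> set T, (forall i, measurable (A i)) ->
      P (tuple_box A) = Q (tuple_box A)) ->
  forall E, measurable E -> P E = Q E.
Proof.
apply: (@tuple_measure_unique _ _ _ _ measurable (fun=> setT)) => //.
- by rewrite sigma_algebra_id//; exact: sigma_algebra_measurable.
- exact: measurableI.
- by apply/seteqP; split => // x _; exists 0%N.
Qed.

(** A box whose sides are the rays []-oo, x i]] is the event measured by the distribution function
    at the corner [x]. *)
Lemma distribution_function_inj (R : realType) p
    (P Q : probability (p.-tuple R) R) :
    (forall x, distribution_function P x = distribution_function Q x) ->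
  forall E, measurable E -> P E = Q E.
Proof.
move=> PQ.
apply: (@tuple_measure_unique _ R _ _ [set A | exists x, A = `]-oo, x]%classic]
  (fun k => `]-oo, k%:R]%classic)) => //.
- apply/seteqP; split => A.
    rewrite [X in X A -> _](RGenOInfty.measurableE R).
    apply: smallest_sub; first exact: smallest_sigma_algebra.
    (* The open right rays generate the Borel sets, and they are the complements of the closed left
       rays. *)
    move=> _ [x ->]; rewrite -setCitvl; apply: sigma_algebraC.
    by apply: sub_sigma_algebra; exists x.
  apply: smallest_sub; first exact: sigma_algebra_measurable.
  by move=> _ [x ->].
- move=> _ _ [x ->] [y ->]; exists (Num.min x y).
  by apply/seteqP; split => z /=; rewrite !in_itv/= le_min => /andP.
- by move=> k; exists k%:R.
- by move=> i j ij x /=; rewrite !in_itv/= => /le_trans; apply; rewrite ler_nat.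
- apply/seteqP; split => // x _; exists (Num.truncn `|x|).+1 => //=.
  by rewrite in_itv/= (le_trans (ler_norm _))// ltW// truncnS_gt.
- move=> A /choice [x Ax]; have := PQ [tuple x i | i < p].
  rewrite /distribution_function (_ : [set y | _] = tuple_box A)//.
  by apply/seteqP; split => y /= yx i;
    have := yx i; rewrite Ax/= in_itv/= tnth_mktuple.
Qed.

(** * The law of an i.i.d. sample and its exchangeability *)

Section cons_tuple.
Context d (T : measurableType d) (n : nat).

Definition cons_pair (z : T * n.-tuple T) : n.+1.-tuple T := cons_tuple z.1 z.2.

Lemma tnth_cons_pair0 z : tnth (cons_pair z) ord0 = z.1.
Proof. exact: tnth0. Qed.

Lemma tnth_cons_pairS z i : tnth (cons_pair z) (lift ord0 i) = tnth z.2 i.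
Proof. exact: tnthS. Qed.

Lemma measurable_cons_pair : measurable_fun setT cons_pair.
Proof. exact: (@measurable_cons _ _ _ _ fst n snd). Qed.

HB.instance Definition _ :=
  isMeasurableFun.Build _ _ _ _ cons_pair measurable_cons_pair.

Lemma preimage_cons_pair_box (A : 'I_n.+1 -> set T) :
  cons_pair @^-1` tuple_box A =
  A ord0 `*` tuple_box (fun i : 'I_n => A (lift ord0 i)).
Proof.
apply/seteqP; split => -[x y] /=.
  by move=> Axy; split=> [|i]; [have := Axy ord0|have := Axy (lift ord0 i)];
    rewrite ?tnth_cons_pair0 ?tnth_cons_pairS.
move=> [A0x Ay] i; case: (unliftP ord0 i) => [j|] ->;
  last by rewrite tnth_cons_pair0.
by rewrite tnth_cons_pairS; exact: Ay.
Qed.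

End cons_tuple.

(** The recursion mirrors that of [lebesgue_tuple], so that one induction on null sets covers both
    measures. *)
Fixpoint iid d (T : measurableType d) (R : realType) (Q : probability T R)
    (n : nat) : probability (n.-tuple T) R :=
  match n with
  | 0 => @dirac _ _ [tuple] R
  | n'.+1 => distribution (Q \x iid Q n')%E (@cons_pair _ T n')
  end.

Section iid_theory.
Context d (T : measurableType d) (R : realType) (Q : probability T R).

Lemma iid_box n (A : 'I_n -> set T) : (forall i, measurable (A i)) ->
  iid Q n (tuple_box A) = (\prod_(i < n) Q (A i))%E.
Proof.
elim: n A => [|n IH] A mA.
  by rewrite big_ord0 /= diracE mem_set//=; case.
rewrite big_ord_recl -IH// /= /distribution /pushforward preimage_cons_pair_box.
by rewrite product_measure1E//; exact: measurable_box.
Qed.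

Definition perm_tuple n (s : 'S_n) (z : n.-tuple T) : n.-tuple T :=
  [tuple tnth z (s i) | i < n].

Lemma measurable_perm_tuple n (s : 'S_n) : measurable_fun setT (perm_tuple s).
Proof.
apply/measurable_fun_tnthP => i; rewrite (_ : _ \o _ = @tnth n T ^~ (s i)).
  exact: measurable_tnth.
by apply/funext => z /=; rewrite tnth_mktuple.
Qed.

HB.instance Definition _ n (s : 'S_n) :=
  isMeasurableFun.Build _ _ _ _ (@perm_tuple n s) (measurable_perm_tuple s).

(** Exchangeability need only be checked on boxes: permuting coordinates permutes the sides, which
    reorders a finite product. *)
Lemma iid_perm n (s : 'S_n) (A : set (n.-tuple T)) : measurable A ->
  iid Q n (perm_tuple s @^-1` A) = iid Q n A.
Proof.
apply: (tuple_probability_unique (P := distribution (iid Q n) (perm_tuple s))).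
move=> {}A mA; rewrite /= /distribution /pushforward.
rewrite (_ : _ @^-1` _ = tuple_box (fun i => A (s^-1 i)%g)); last first.
  apply/seteqP; split => z /= Az i; last first.
    by rewrite tnth_mktuple; have := Az (s i); rewrite permK.
  by have := Az (s^-1 i)%g; rewrite tnth_mktuple permKV.
by rewrite !iid_box// (reindex_inj (@perm_inj _ s))/=;
  apply: eq_bigr => i _; rewrite permK.
Qed.

End iid_theory.

(** * Null level sets of sums over coordinates *)

Lemma product_measure_ysection0 d1 d2 (T1 : measurableType d1)
    (T2 : measurableType d2) (R : realType)
    (m1 : {sigma_finite_measure set T1 -> \bar R})
    (m2 : {sigma_finite_measure set T2 -> \bar R}) (A : set (T1 * T2)) :
  measurable A -> (forall y, m1 (ysection A y) = 0%E) -> (m1 \x m2)%E A = 0%E.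
Proof.
(* The product measure integrates sections at fixed first coordinate. By uniqueness it equals the
   product taken in the other order, which integrates the [ysection]s. *)
move=> mA A0; rewrite (@product_measure_unique _ _ _ _ _ m1 m2 (m1 \x^ m2)%E)//.
  by apply: integral0_eq => y _ /=.
by move=> B C mB mC; exact: product_measure2E.
Qed.

Lemma measurable_level_set d (T : measurableType d) (R : realType) (f : T -> R)
    (c : R) :
  measurable_fun setT f -> measurable [set x | f x = c].
Proof.
by move=> mf; rewrite -[X in measurable X]setTI; exact: (mf _ [set c]).
Qed.

Lemma measurable_sum_tnth d (T : measurableType d) (R : realType) n
    (f : 'I_n -> T -> R) :
  (forall i, measurable_fun setT (f i)) ->
  measurable_fun setT (fun z : n.-tuple T => \sum_(i < n) f i (tnth z i)).
Proof.
move=> mf; apply: measurable_sum => i; apply: measurableT_comp => //.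
exact: measurable_tnth.
Qed.

(* [mu n] is the [n]-th power of [nu], given by its recurrence so as to cover
   both [lebesgue_tuple] and [iid]. The map [j] is the identity in both cases:
   [lebesgue_measure] lives on [measurableTypeR R], whose measurable structure
   has another display than that of [R]. *)
Lemma sum_level_set_null d d' (T : measurableType d) (T' : measurableType d')
    (R : realType) (j : T' -> T) (mj : measurable_fun setT j)
    (nu : {sigma_finite_measure set T' -> \bar R})
    (mu : forall n, {sigma_finite_measure set (n.-tuple T) -> \bar R})
    (muS : forall n A, mu n.+1 A =
      (nu \x mu n)%E ((fun z => cons_pair (j z.1, z.2)) @^-1` A))
    n (f : 'I_n -> T -> R) (k : 'I_n) :
    (forall i, measurable_fun setT (f i)) ->
    (forall c, nu [set x | f k (j x) = c] = 0%E) ->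
  forall c, mu n [set z | \sum_(i < n) f i (tnth z i) = c] = 0%E.
Proof.
elim: n f k => [|n IH] f k mf fk0 c; first by case: k fk0.
rewrite muS; set A := _ @^-1` _.
have AE : A = [set z |
    f ord0 (j z.1) + \sum_(i < n) f (lift ord0 i) (tnth z.2 i) = c].
  apply/funext => z; rewrite /A /= big_ord_recl tnth_cons_pair0.
  by congr (_ + _ = c); apply: eq_bigr => i _; rewrite tnth_cons_pairS.
have mA : measurable A.
  have mcons : measurable_fun setT
      (fun z : T' * n.-tuple T => cons_pair (j z.1, z.2)).
    apply: (@measurable_cons _ _ _ _ (j \o fst) n snd) => //.
    exact: measurableT_comp.
  rewrite -[X in measurable X]setTI; apply: mcons => //.
  by apply: measurable_level_set; exact: measurable_sum_tnth.
case: (unliftP ord0 k) fk0 => [i|] -> {k} fk0.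
  (* The good coordinate lies in the tail: with the head fixed, the section is a level set of the
     tail sum, null by induction. *)
  apply: integral0_eq => x _ /=; rewrite xsectionE AE.
  rewrite -[RHS](IH (fun i => f (lift ord0 i)) i _ _ (c - f ord0 (j x)))//.
  congr (mu n _); apply/seteqP; split => z /=.
    by move=> <-; rewrite addrC addKr.
  by move=> ->; rewrite addrC subrK.
(* The good coordinate is the head: with the tail fixed, the section is a level set of the head
   function, null by hypothesis. *)
apply: product_measure_ysection0 => // z; rewrite ysectionE AE.
rewrite -[RHS](fk0 (c - \sum_(i < n) f (lift ord0 i) (tnth z i))).
congr (nu _); apply/seteqP; split => x /=; first by move=> <-; rewrite addrK.
by move=> ->; rewrite subrK.
Qed.

Lemma iid_level_set_null d (T : measurableType d) (R : realType)
    (Q : probability T R) n (f : 'I_n -> T -> R) (k : 'I_n) :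
    (forall i, measurable_fun setT (f i)) ->
    (forall c, Q [set x | f k x = c] = 0%E) ->
  forall c, iid Q n [set z | \sum_(i < n) f i (tnth z i) = c] = 0%E.
Proof. exact: (@sum_level_set_null _ _ _ _ _ id _ Q (iid Q)). Qed.

Lemma lebesgue_hyperplane_null (R : realType) p (a : 'I_p -> R) (k : 'I_p)
    (c : R) :
  a k != 0 ->
  lebesgue_tuple R p [set x | \sum_(i < p) a i * tnth x i = c] = 0%E.
Proof.
move=> ak0; have mj : measurable_fun setT (id : measurableTypeR R -> R) by [].
apply: (@sum_level_set_null _ _ _ _ _ _ mj (@lebesgue_measure R)
  (lebesgue_tuple R) _ _ (fun i x => a i * x) k) => [//|i|{}c].
  exact: mulrl_measurable.
rewrite (_ : [set _ | _] = [set c / a k]).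
  exact: lebesgue_measure_set1.
apply/seteqP; split => x /=; first by move=> <-; rewrite mulrAC divff// mul1r.
by move=> ->; rewrite mulrC divfK.
Qed.

(** This is where absolute continuity enters the proof: it transfers the nullity of hyperplanes from
    Lebesgue measure to [Q]. *)
Lemma ac_hyperplane_null (R : realType) p (Q : probability (p.-tuple R) R)
    (a : 'I_p -> R) (k : 'I_p) (c : R) :
  absolutely_continuous Q -> a k != 0 ->
  Q [set x | \sum_(i < p) a i * tnth x i = c] = 0%E.
Proof.
move=> /null_content_dominatesP Qac ak0; apply: Qac; last first.
  exact: lebesgue_hyperplane_null ak0.
apply: measurable_level_set.
apply: (measurable_sum_tnth (f := fun i => *%R (a i))) => i.
exact: mulrl_measurable.
Qed.

(** * Assignments of sample points to grid points, and their costs *)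

Section assignment.
Context (R : realType) (p N : nat) (g : 'I_N -> p.-tuple R).
Implicit Types (s t : 'S_N) (z : N.-tuple (p.-tuple R)).

Definition assignment_cost s z : R := \sum_(i < N) sqdist (g (s i)) (tnth z i).

(** Strictness makes these events pairwise disjoint. They will cover the sample space up to a null
    set. *)
Definition strict_optimum s : set (N.-tuple (p.-tuple R)) :=
  [set z | forall t, t != s -> assignment_cost s z < assignment_cost t z].

Lemma measurable_sqdist (y : p.-tuple R) : measurable_fun setT (sqdist y).
Proof.
apply: (measurable_sum _
  (h := fun i (x : p.-tuple R) => (tnth y i - tnth x i) ^+ 2)) => i.
apply: measurable_funX; apply: measurable_funB; first exact: measurable_cst.
exact: measurable_tnth.
Qed.

Lemma measurable_assignment_cost s : measurable_fun setT (assignment_cost s).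
Proof.
by apply: (measurable_sum_tnth (f := fun i => sqdist (g (s i)))) => i;
  exact: measurable_sqdist.
Qed.

Lemma measurable_strict_optimum s : measurable (strict_optimum s).
Proof.
rewrite (_ : strict_optimum s = \bigcap_(t in [set t | t != s])
    [set z | assignment_cost s z < assignment_cost t z]) //.
apply: fin_bigcap_measurable => [|t _]; first exact: finite_finset.
rewrite -[X in measurable X]setTI.
apply: (measurable_fun_ltr _ _ measurableT (Y := [set true])) => //;
  exact: measurable_assignment_cost.
Qed.

Lemma trivIset_strict_optimum (D : set 'S_N) : trivIset D strict_optimum.
Proof.
move=> s t _ _ [z [sz tz]]; apply/eqP; apply: contraT => st.
have := lt_trans (tz _ st) (sz t _); rewrite ltxx; apply.
by rewrite eq_sym.
Qed.

(** Reindex the sum by the inverse of [t]; in a product of permutations the left factor acts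
    first. *)
Lemma assignment_cost_perm s t z :
  assignment_cost s (perm_tuple t z) = assignment_cost (t^-1 * s)%g z.
Proof.
rewrite /assignment_cost (reindex_inj (@perm_inj _ t^-1%g))/=.
by apply: eq_bigr => i _; rewrite tnth_mktuple permKV permM.
Qed.

Lemma strict_optimum_perm s :
  perm_tuple s @^-1` strict_optimum s = strict_optimum 1%g.
Proof.
apply/seteqP; split => z /= sz t ts.
  (* The competitor [s * t] of [s] turns into the competitor [t] of the identity once the sample is
     permuted. *)
  have := sz (s * t)%g; rewrite !assignment_cost_perm mulVg mulKg; apply.
  by rewrite -{2}(mulg1 s) (inj_eq (mulgI s)).
rewrite !assignment_cost_perm mulVg; apply: sz.
by rewrite -(mulVg s) (inj_eq (mulgI _)).
Qed.

(** The squares of the coordinates of [z] cancel, so the difference is affine in [z], with normal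
    vector [2 (y - x)]; its level sets are hyperplanes when [x] and [y] differ. *)
Lemma sqdistB (x y z : p.-tuple R) :
  sqdist x z - sqdist y z =
  \sum_(k < p) (tnth x k ^+ 2 - tnth y k ^+ 2) +
  \sum_(k < p) ((tnth y k - tnth x k) *+ 2) * tnth z k.
Proof.
rewrite -sumrB -big_split/=; apply: eq_bigr => k _; ring.
Qed.

Variable Q : probability (p.-tuple R) R.

Lemma strict_optimum_prob_const s :
  iid Q N (strict_optimum s) = iid Q N (strict_optimum 1%g).
Proof.
rewrite -(strict_optimum_perm s) iid_perm//; exact: measurable_strict_optimum.
Qed.

Hypotheses (g_inj : injective g) (Qac : absolutely_continuous Q).

Lemma sqdistB_null (x y : p.-tuple R) c : x != y ->
  Q [set z | sqdist x z - sqdist y z = c] = 0%E.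
Proof.
move=> xy; have [k xyk] : exists k, tnth y k != tnth x k.
  apply/existsP; apply: contraR xy; rewrite negb_exists => /forallP xy.
  by apply/eqP/eq_from_tnth => k; apply/esym/eqP; have := xy k; rewrite negbK.
set b := \sum_(k < p) (tnth x k ^+ 2 - tnth y k ^+ 2).
rewrite -[RHS](ac_hyperplane_null (k := k)
  (a := fun k => (tnth y k - tnth x k) *+ 2) (c - b) Qac).
  congr (Q _); apply/seteqP; split => z /=; rewrite sqdistB.
    by move=> <-; rewrite addrC addKr.
  by move=> ->; rewrite addrC subrK.
by rewrite mulrn_eq0/= subr_eq0.
Qed.

(** The cost difference is a sum of functions of one observation each. At an index where [s] and [t]
    differ, the two grid points are distinct, so that term has null level sets. *)
Lemma assignment_cost_tie_null s t : s != t ->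
  iid Q N [set z | assignment_cost s z = assignment_cost t z] = 0%E.
Proof.
move=> st; have [k stk] : exists k, s k != t k.
  apply/existsP; apply: contraR st; rewrite negb_exists => /forallP st.
  by apply/eqP/permP => k; apply/eqP; have := st k; rewrite negbK.
rewrite -[RHS](iid_level_set_null (Q := Q) (k := k)
  (f := fun i x => sqdist (g (s i)) x - sqdist (g (t i)) x) _ _ 0).
- congr (iid Q N _); apply/seteqP; split => z /=;
    rewrite /assignment_cost sumrB; first by move=> ->; rewrite subrr.
  by move/eqP; rewrite subr_eq0 => /eqP.
- by move=> i; apply: measurable_funB; exact: measurable_sqdist.
- by move=> c; apply: sqdistB_null; rewrite (inj_eq g_inj).
Qed.

(** There are finitely many pairs of assignments, so almost surely no two costs tie, and then a
    minimizer is a strict one. *)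
Lemma strict_optimum_ae :
  {ae iid Q N, forall z, exists s, strict_optimum s z}.
Proof.
have noties : {ae iid Q N, forall z (st : 'S_N * 'S_N), st.1 != st.2 ->
    assignment_cost st.1 z <> assignment_cost st.2 z}.
  apply: filter_forall => -[s t] /=.
  have [->|st] := eqVneq s t; first exact: aeW.
  exists [set z | assignment_cost s z = assignment_cost t z]; split.
  - rewrite -[X in measurable X]setTI.
    rewrite (_ : [set z | _] =
        [set z | assignment_cost s z == assignment_cost t z]).
      apply: (measurable_fun_eqr _ _ measurableT (Y := [set true])) => //;
        exact: measurable_assignment_cost.
    by apply/seteqP; split => z /= /eqP.
  - exact: assignment_cost_tie_null.
  - by move=> z /= h; apply: contrapT => E; apply: h.
apply: filterS noties => z zN.
case: (arg_minP (fun s => assignment_cost s z) (i0 := 1%g) (P := predT))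
  => // s _ smin.
exists s => t ts; rewrite lt_neqAle smin// andbT eq_sym.
by apply/eqP; exact: (zN (t, s)).
Qed.

Lemma prob_split_strict_optimum (A : set (N.-tuple (p.-tuple R))) :
  measurable A ->
  iid Q N A = (\sum_s iid Q N (A `&` strict_optimum s))%E.
Proof.
move=> mA; set U := \bigcup_s strict_optimum s.
have mU : measurable U.
  apply: fin_bigcup_measurable => [|s _]; first exact: finite_finset.
  exact: measurable_strict_optimum.
have AU0 : iid Q N (A `\` U) = 0%E.
  apply: measure_negligible; first exact: measurableD.
  apply: negligibleS strict_optimum_ae => z [_ Uz] [s sz].
  by apply: Uz; exists s.
transitivity (iid Q N (A `&` U)).
  by rewrite [LHS](measureDI _ mA mU) [X in (X + _)%E]AU0 add0e.
rewrite setI_bigcupr [LHS]measure_fin_bigcup.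
- rewrite fsbig_finite/=; last exact: finite_finset.
  apply: perm_big; rewrite uniq_perm ?index_enum_uniq ?finmap.fset_uniq// => s.
  rewrite mem_index_enum in_fset_set; first exact: mem_set.
  exact: finite_finset.
- exact: finite_finset.
- exact/trivIset_setIl/trivIset_strict_optimum.
- by move=> s _; apply: measurableI => //; exact: measurable_strict_optimum.
Qed.

(** The [N!] events are equally likely by exchangeability, and their probabilities add up to one. *)
Lemma strict_optimum_prob s :
  iid Q N (strict_optimum s) = (N`!%:R^-1)%:E.
Proof.
rewrite strict_optimum_prob_const.
have := prob_split_strict_optimum measurableT.
rewrite probability_setT => /esym.
under eq_bigr do rewrite setTI strict_optimum_prob_const.
have : iid Q N (strict_optimum 1%g) \is a fin_num.
  by apply: fin_num_measure; exact: measurable_strict_optimum.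
move/fineK => <-; rewrite sumEFin sumr_const card_Sn => -[q1].
have N0 : N`!%:R != 0 :> R by rewrite pnatr_eq0 -lt0n fact_gt0.
by congr EFin; apply: (mulIf N0); rewrite mulVf// mulr_natr.
Qed.

End assignment.

(** * The law of a function of a uniform random index *)

Section uniform_law.
Context (R : realType) (I : finType) (i0 : I) (f : I -> R).

(** Each value of [f] is weighted by its multiplicity. The index [i0] is the default of [nth] and
    witnesses that the mass [#|I|] is positive. *)
Definition uniform_law : probability R R :=
  mnormalize (msum (fun k => @dirac _ R (f (nth i0 (enum I) k)) R) #|I|)
    (@dirac _ R 0 R).

Lemma uniform_lawE (B : set R) :
  uniform_law B = ((\sum_(i : I) \1_B (f i)) / #|I|%:R)%:E.
Proof.
set mu : {measure set R -> \bar R} :=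
  msum (fun k => @dirac _ R (f (nth i0 (enum I) k)) R) #|I|.
have muE (A : set R) : mu A = (\sum_(i : I) \1_A (f i))%:E.
  rewrite -sumEFin -big_enum/= (big_nth i0) big_mkord -cardE.
  by apply: eq_bigr.
have I0 : (#|I| != 0)%N by rewrite -lt0n; apply/card_gt0P; exists i0.
rewrite /uniform_law /= /mnormalize -/mu !muE.
have -> : \sum_(i : I) \1_(@setT R) (f i) = #|I|%:R :> R.
  by rewrite (eq_bigr (fun=> 1)) ?sumr_const// => i _; rewrite indicT.
by rewrite eqe pnatr_eq0 (negbTE I0)/= -/mu muE EFinM.
Qed.

End uniform_law.

(** * From optimal transport maps to optimal permutations *)

Section optimal_transport.
Context (R : realType) (p N : nat) (g : 'I_N -> p.-tuple R).
Implicit Types (s : 'S_N) (z : N.-tuple (p.-tuple R)).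

(** If two sample points coincided, swapping their images would give another assignment of equal
    cost. *)
Lemma strict_optimum_injective s z :
  strict_optimum g s z -> injective (tnth z).
Proof.
move=> sz i j zij; apply: contrapT => /eqP ij.
have := sz (tperm i j * s)%g.
suff -> : assignment_cost g (tperm i j * s)%g z = assignment_cost g s z.
  rewrite ltxx => /(_ _)/notF; apply; apply: contra ij => /eqP tE.
  have /permP/(_ i) : tperm i j = 1%g by apply: (mulIg s); rewrite mul1g.
  by rewrite tpermL perm1 => ->.
rewrite -[tperm i j]tpermV -assignment_cost_perm; congr assignment_cost.
by apply: eq_from_tnth => k; rewrite tnth_mktuple; case: tpermP => // ->.
Qed.

(** The map [G] induces a permutation [t0] of the indices. Its cost is at most that of [s], because
    [s] too is realized by a bijection; strict optimality then forces [t0] to be [s]. *)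
Lemma optimal_transport_strict_optimum s z (G : p.-tuple R -> p.-tuple R) :
  injective g -> strict_optimum g s z -> optimal_transport (tnth z) g G ->
  forall i, G (tnth z i) = g (s i).
Proof.
move=> g_inj sz [[Gfun Ginj _] Gmin].
have z_inj := strict_optimum_injective sz.
have /choice [t0 t0E] : forall i, exists j, g j = G (tnth z i).
  by move=> i; have [|j _ gj] := Gfun (tnth z i); [exists i|exists j].
have t0_inj : injective t0.
  move=> i j tij; apply: z_inj; apply: Ginj;
    rewrite ?inE; [by exists i|by exists j|].
  by rewrite -!t0E tij.
(* [H] realizes [s] on the sample points and is the identity elsewhere. *)
pose H x := if [pick i | tnth z i == x] is Some i then g (s i) else x.
have HE i : H (tnth z i) = g (s i).
  rewrite /H; case: pickP => [j /eqP/z_inj ->//|/(_ i)].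
  by rewrite eqxx.
have Hbij : set_bij (range (tnth z)) (range g) H.
  split.
  - by move=> _ [i _ <-]; rewrite HE; exists (s i).
  - move=> _ _ /set_mem[i _ <-] /set_mem[j _ <-].
    by rewrite !HE => /g_inj/perm_inj ->.
  - move=> _ [j _ <-]; exists (tnth z (s^-1 j)%g); first by exists (s^-1 j)%g.
    by rewrite HE permKV.
have : assignment_cost g (perm t0_inj) z <= assignment_cost g s z.
  rewrite /assignment_cost; under eq_bigr do rewrite permE t0E.
  by under [leRHS]eq_bigr do rewrite -HE; exact: Gmin.
have [<- _ i|ts] := eqVneq (perm t0_inj) s; first by rewrite permE t0E.
by rewrite leNgt sz.
Qed.

End optimal_transport.

(** * The law of the pooled sample *)

Section pooled_sample.
Context d (Omega : measurableType d) (R : realType) (P : probability Omega R).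

Lemma sample_vector_box d' (T : measurableType d') (Q : probability T R) k
    (X : 'I_k -> {RV P >-> T}) (A : 'I_k -> set T) :
  random_sample Q X -> (forall i, measurable (A i)) ->
  P (sample_vector X @^-1` tuple_box A) = (\prod_(i < k) Q (A i))%E.
Proof.
move=> [Xind XQ] mA.
rewrite (_ : _ @^-1` _ =
    \bigcap_(i in [set i | i \in [set: 'I_k]%SET]) (X i @^-1` A i)).
  rewrite Xind//; apply: eq_big => [i|i _]; first by rewrite finset.in_setT.
  exact: XQ.
apply/seteqP; split => omega /= h i;
  first by move=> _; have := h i; rewrite tnth_mktuple.
by rewrite tnth_mktuple; apply: h; rewrite /= finset.in_setT.
Qed.

Context (p n m : nat).
Variables (X : 'I_n -> {RV P >-> p.-tuple R})
  (X0 : 'I_m -> {RV P >-> p.-tuple R}).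

Definition pooled_tuple (omega : Omega) : (n + m).-tuple (p.-tuple R) :=
  [tuple pooled (fun i => X i omega) (fun j => X0 j omega) i | i < n + m].

Lemma pooled_lshift (x : 'I_n -> p.-tuple R) (x0 : 'I_m -> p.-tuple R) i :
  pooled x x0 (lshift m i) = x i.
Proof. by rewrite /pooled (unsplitK (inl i)). Qed.

Lemma pooled_rshift (x : 'I_n -> p.-tuple R) (x0 : 'I_m -> p.-tuple R) i :
  pooled x x0 (rshift n i) = x0 i.
Proof. by rewrite /pooled (unsplitK (inr i)). Qed.

Lemma measurable_pooled_tuple : measurable_fun setT pooled_tuple.
Proof.
apply/measurable_fun_tnthP => i.
rewrite (_ : _ \o _ =
    fun omega => pooled (fun i => X i omega) (fun j => X0 j omega) i).
  by rewrite /pooled; case: fintype.split.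
by apply/funext => omega /=; rewrite tnth_mktuple.
Qed.

HB.instance Definition _ :=
  isMeasurableFun.Build _ _ _ _ pooled_tuple measurable_pooled_tuple.

(** On a box, independence of the two samples splits the probability into a factor for the first [n]
    sides and one for the last [m]. *)
Lemma pooled_tuple_law (Q : probability (p.-tuple R) R) :
  random_sample Q X -> random_sample Q X0 -> independent_samples X X0 ->
  forall E, measurable E -> P (pooled_tuple @^-1` E) = iid Q (n + m) E.
Proof.
move=> XQ X0Q XX0.
apply: (tuple_probability_unique (P := distribution P pooled_tuple)).
move=> A mA; rewrite iid_box// big_split_ord/=.
rewrite -(sample_vector_box XQ)// -(sample_vector_box X0Q)// -XX0;
  [|exact: measurable_box..].
rewrite /distribution /pushforward; congr (P _).
apply/seteqP; split => omega /=.
  by move=> h; split => i; rewrite tnth_mktuple;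
    [have := h (lshift m i)|have := h (rshift n i)];
    rewrite tnth_mktuple ?pooled_lshift ?pooled_rshift.
move=> [h h0] i; rewrite tnth_mktuple; case: (split_ordP i) => j ->.
  by have := h j; rewrite tnth_mktuple pooled_lshift.
by have := h0 j; rewrite tnth_mktuple pooled_rshift.
Qed.

End pooled_sample.

(** * The law of a statistic determined by the optimal assignment *)

Lemma strict_optimum_law (R : realType) (p N : nat) (g : 'I_N -> p.-tuple R)
    (Q : probability (p.-tuple R) R) (f : 'S_N -> R)
    d (Omega : measurableType d) (P : probability Omega R)
    (Z : {RV P >-> N.-tuple (p.-tuple R)}) (h : Omega -> R) :
    injective g -> absolutely_continuous Q ->
    (forall E, measurable E -> P (Z @^-1` E) = iid Q N E) ->
    (forall omega s, strict_optimum g s (Z omega) -> h omega = f s) ->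
  has_law P h (uniform_law 1%g f).
Proof.
move=> g_inj Qac ZQ hf.
(* [h] is not assumed measurable, so a measurable version is built: on a strict optimum one term of
   the sum survives. *)
pose y z : R := \sum_s f s * \1_(strict_optimum g s) z.
have yE s z : strict_optimum g s z -> y z = f s.
  move=> sz; rewrite /y (bigD1 s)//= indicE mem_set// mulr1.
  rewrite big1 ?addr0// => t ts; rewrite indicE memNset ?mulr0// => tz.
  have /eqP := @trivIset_strict_optimum _ _ _ g setT t s I I
    (ex_intro _ z (conj tz sz)).
  by rewrite (negbTE ts).
have my : measurable_fun setT y.
  apply: measurable_sum => s; apply: measurable_funM => //.
  by apply: measurable_indic; exact: measurable_strict_optimum.
have myB B : measurable B -> measurable (y @^-1` B).
  by move=> mB; rewrite -[X in measurable X]setTI; exact: my.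
pose Y : {RV P >-> R} := HB.pack (y \o Z) (isMeasurableFun.Build _ _ _ _
  (y \o Z) (measurableT_comp my (measurable_funPT Z))).
exists Y; split.
  have [M [mM M0 NM]] := strict_optimum_ae g_inj Qac.
  (* [h] and [Y] can differ only where no strict optimum exists, which lies in the preimage of the
     null set [M]. *)
  exists (Z @^-1` M); split.
  - by rewrite -[X in measurable X]setTI; exact: measurable_funPT.
  - by rewrite ZQ.
  - move=> omega /= hY; apply: NM => -[s sZ]; apply: hY.
    by rewrite (hf _ _ sZ) -(yE _ _ sZ).
move=> B mB; rewrite uniform_lawE /distribution /pushforward /=.
rewrite comp_preimage (ZQ _ (myB _ mB)).
(* On the event of [s] the variable equals [f s], so each piece is either the whole event, of
   probability [1/N!], or empty. *)
rewrite [LHS](prob_split_strict_optimum g_inj Qac (myB _ mB)) card_Sn.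
rewrite mulr_suml -sumEFin; apply: eq_bigr => s _.
rewrite indicE; have [sB|sB] := boolP (f s \in B).
  rewrite mul1r -(strict_optimum_prob g_inj Qac s); congr (iid _ _ _).
  apply/seteqP; split => [z []//|z sz]; split => //=.
  by rewrite (yE _ _ sz); exact: set_mem.
rewrite mul0r (_ : _ `&` _ = set0) ?measure0//.
apply/seteqP; split => // z /= [yB sz]; move: sB.
by rewrite -(yE _ _ sz) mem_set.
Qed.

Theorem lemma1 (R : realType) (p n m : nat)
    (p_ge1 : (1 <= p)%N) (n_ge1 : (1 <= n)%N) (m_ge1 : (1 <= m)%N)
    (g : 'I_(n + m) -> p.-tuple R) (g_inj : injective g)
    (w : p.-tuple R -> R) (w_weight : weight_function w) :
  exists L : probability R R,
  forall (PX P0 : probability (p.-tuple R) R)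
    (PX_ac : absolutely_continuous PX) (P0_ac : absolutely_continuous P0)
    (H0 : forall x, distribution_function PX x = distribution_function P0 x)
    (d : measure_display) (Omega : measurableType d) (P : probability Omega R)
    (X : 'I_n -> {RV P >-> p.-tuple R}) (X0 : 'I_m -> {RV P >-> p.-tuple R})
    (X_sample : random_sample PX X) (X0_sample : random_sample P0 X0)
    (X_X0_indep : independent_samples X X0)
    (G : Omega -> p.-tuple R -> p.-tuple R)
    (G_opt : forall omega : Omega,
      let Z := pooled (fun i => X i omega) (fun j => X0 j omega) in
      injective Z -> optimal_transport Z g (G omega)),
  has_law P
    (fun omega => test_statistic w (fun i => G omega (X i omega))
                                   (fun j => G omega (X0 j omega)))
    L.
Proof.
(* The common law is that of the statistic when the grid points are dealt out by a uniform
   permutation, the first [n] indices going to the first sample. *)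
exists (uniform_law 1%g (fun s : 'S_(n + m) => test_statistic w
  (fun i => g (s (lshift m i))) (fun j => g (s (rshift n j))))).
move=> PX P0 PX_ac _ H0 d Omega P X X0 XPX [X0ind X0P0] XX0 G G_opt.
(* Equal distribution functions give equal laws, so both samples are drawn from [PX]. *)
have X0PX : random_sample PX X0.
  by split=> // i A mA; rewrite X0P0// (distribution_function_inj H0).
apply: (strict_optimum_law (Z := pooled_tuple X X0) g_inj PX_ac).
  exact: pooled_tuple_law.
move=> omega s sZ; have tnthZ : tnth (pooled_tuple X X0 omega) =
    pooled (fun i => X i omega) (fun j => X0 j omega).
  by apply/funext => i; rewrite tnth_mktuple.
(* [G] is constrained only at distinct sample points, and a strict optimum guarantees that they are
   distinct. *)
have /G_opt : injective (pooled (fun i => X i omega) (fun j => X0 j omega)).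
  by rewrite -tnthZ; exact: strict_optimum_injective sZ.
rewrite -tnthZ => /(optimal_transport_strict_optimum g_inj sZ).
rewrite tnthZ => GE.
congr (test_statistic w _ _); apply/funext => i.
  by rewrite -GE pooled_lshift.
by rewrite -GE pooled_rshift.
Qed.
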